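(* Let $X^{\mathfrak{l}}:[0,1]\to\mathbb{R}$ be smooth for every $\mathfrak{l}\in\mathfrak{L}$. For $\mathbf{x}:[0,1]^2\to T^*$ (such that the integrals below make sense), the hierarchy of equations $$\mathbf{x}_{st\,\beta}=\sum_{(\mathfrak{l},k)\in\mathfrak{L}\times\mathbb{N}_0}\ \sum_{e_{(\mathfrak{l},k)}+\beta_1+\dots+\beta_k=\beta}\int_s^t\mathbf{x}_{su\,\beta_1}\cdots\mathbf{x}_{su\,\beta_k}\,dX^{\mathfrak{l}}_u,\qquad\beta\in M(\mathfrak{L}\times\mathbb{N}_0),$$ is equivalent to $$\mathbf{x}_{st}=\sum_{\mathfrak{l}\in\mathfrak{L}}\int_s^t\rho_D\big(\exp_D(\mathbf{x}_{su})\big)\mathsf{z}_{(\mathfrak{l},0)}\,dX^{\mathfrak{l}}_u.$$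
   Context: $\mathfrak{L}$ is a finite set, $\mathbb{N}_0=\{0,1,\dots\}$. For a countable set $S$, $M(S)$ is the set of finitely supported functions $I:S\to\mathbb{N}_0$, $e_s$ the indicator of $s$, $I!=\prod I(s)!$. $\mathsf{z}^\beta=\prod\mathsf{z}_{(\mathfrak{l},k)}^{\beta(\mathfrak{l},k)}$, $\beta\in M(\mathfrak{L}\times\mathbb{N}_0)$, are monomials in commuting variables. $[\beta]=\sum(1-k)\beta(\mathfrak{l},k)$; $\mathcal{T}=\{\beta:[\beta]=1\}$; $T=\mathrm{span}\{\mathsf{z}^\beta\}_{\beta\in\mathcal{T}}$; $T^*$ is the space of formal series $\sum_{\beta\in\mathcal{T}}\pi_\beta\mathsf{z}^\beta$ (so $\pi_\beta=0$ for $\beta\notin\mathcal{T}$). $D=\sum(k+1)\mathsf{z}_{(\mathfrak{l},k+1)}\partial_{\mathsf{z}_{(\mathfrak{l},k)}}$; $T$ is a pre-Lie algebra under $\pi D\pi'=\pi\cdot(D\pi')$. In the first equation the inner sum runs over ordered tuples $(\beta_1,\dots,\beta_k)$ (for $k=0$ the product is $1$), and integrals are classical and taken componentwise. $U(T,D)$ is the universal enveloping algebra of $T$ with bracket $\pi D\pi'-\pi'D\pi$; $\rho_D:U(T,D)\to\mathrm{End}(T)$ is the algebra morphism extending $\rho_D(\pi)\pi'=\pi D\pi'$. Define $\star_D:U(T,D)\times T\to U(T,D)$ by $1\star_Da=a$, $(a'U)\star_Da=a'(U\star_Da)-U\star_D(a'Da)$ for $a,a'\in T$. For $I=e_{\beta_1}+\dots+e_{\beta_n}\in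 M(\mathcal{T})$, $\mathsf{Z}_I=\frac1{I!}(\cdots(1\star_D\mathsf{z}^{\beta_1})\cdots)\star_D\mathsf{z}^{\beta_n}$ (independent of order). For $\mathbf{f}=\sum_\beta\mathbf{f}_\beta\mathsf{z}^\beta\in T^*$ put $\mathbf{f}^I=\prod_\beta\mathbf{f}_\beta^{I(\beta)}$, $\exp_D(\mathbf{f})=\sum_{I\in M(\mathcal{T})}\mathbf{f}^I\mathsf{Z}_I$ (formal sum), and $\rho_D(\exp_D(\mathbf{f}))=\sum_I\mathbf{f}^I\rho_D(\mathsf{Z}_I)$, a well-defined endomorphism of $T^*$ (finite sums in each component). *)

(* Defs.v *)
From HB Require Import structures.
From mathcomp Require Import all_boot all_order all_algebra finmap.
From mathcomp Require Import all_classical all_reals all_analysis.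
From mathcomp Require Import ring.
(* The notations of [monalg] clash with those of MathComp-Analysis. *)
From mathcomp Require Import -(notations) monalg.
Set Implicit Arguments.
Unset Strict Implicit.
Unset Printing Implicit Defensive.
Import Order.TTheory GRing.Theory Num.Theory.
Local Open Scope ring_scope.
Local Open Scope fset_scope.
Local Open Scope quotient_scope.
Local Open Scope classical_set_scope.
Local Open Scope ring_scope.

(* The enveloping algebra of a module [g] with a bracket [br]: the free unital
   associative R-algebra on the module [g], divided by the relations
   [a, b] = ab - ba. It is built as the quotient of formal expressions by the
   smallest congruence satisfying the algebra axioms, linearity of the inclusion
   of [g], and these relations; [envalg_lift] and [envalg_lift_uniq] below are
   its universal property. *)
Section Enveloping.
Variables (R : comNzRingType) (g : lmodType R) (br : g -> g -> g).

Inductive uexpr : Type :=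
| UGen of g
| UZero
| UOne
| UOpp of uexpr
| UAdd of uexpr & uexpr
| UMul of uexpr & uexpr
| UScale of R & uexpr.

Inductive ucongr : uexpr -> uexpr -> Prop :=
| ucongr_refl e : ucongr e e
| ucongr_sym e f : ucongr e f -> ucongr f e
| ucongr_trans e f h : ucongr e f -> ucongr f h -> ucongr e h
| ucongr_opp e e' : ucongr e e' -> ucongr (UOpp e) (UOpp e')
| ucongr_add e e' f f' :
    ucongr e e' -> ucongr f f' -> ucongr (UAdd e f) (UAdd e' f')
| ucongr_mul e e' f f' :
    ucongr e e' -> ucongr f f' -> ucongr (UMul e f) (UMul e' f')
| ucongr_scale c e e' : ucongr e e' -> ucongr (UScale c e) (UScale c e')
| ucongr_addA e f h : ucongr (UAdd e (UAdd f h)) (UAdd (UAdd e f) h)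
| ucongr_addC e f : ucongr (UAdd e f) (UAdd f e)
| ucongr_add0 e : ucongr (UAdd UZero e) e
| ucongr_addN e : ucongr (UAdd (UOpp e) e) UZero
| ucongr_scaleA c d e : ucongr (UScale c (UScale d e)) (UScale (c * d) e)
| ucongr_scale1 e : ucongr (UScale 1 e) e
| ucongr_scaleDr c e f :
    ucongr (UScale c (UAdd e f)) (UAdd (UScale c e) (UScale c f))
| ucongr_scaleDl e c d :
    ucongr (UScale (c + d) e) (UAdd (UScale c e) (UScale d e))
| ucongr_mulA e f h : ucongr (UMul e (UMul f h)) (UMul (UMul e f) h)
| ucongr_mul1l e : ucongr (UMul UOne e) e
| ucongr_mul1r e : ucongr (UMul e UOne) e
| ucongr_mulDl e f h :
    ucongr (UMul (UAdd e f) h) (UAdd (UMul e h) (UMul f h))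
| ucongr_mulDr e f h :
    ucongr (UMul e (UAdd f h)) (UAdd (UMul e f) (UMul e h))
| ucongr_scaleAl c e f : ucongr (UScale c (UMul e f)) (UMul (UScale c e) f)
| ucongr_scaleAr c e f : ucongr (UScale c (UMul e f)) (UMul e (UScale c f))
| ucongr_genD a b : ucongr (UGen (a + b)) (UAdd (UGen a) (UGen b))
| ucongr_genZ c a : ucongr (UGen (c *: a)) (UScale c (UGen a))
| ucongr_genB a b :
    ucongr (UGen (br a b))
      (UAdd (UMul (UGen a) (UGen b)) (UOpp (UMul (UGen b) (UGen a)))).

HB.instance Definition _ := gen_eqMixin uexpr.
HB.instance Definition _ := gen_choiceMixin uexpr.

Definition ucongrb (e f : uexpr) : bool := `[< ucongr e f >].

Lemma ucongrb_refl : reflexive ucongrb.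
Proof. by move=> e; apply/asboolP; exact: ucongr_refl. Qed.
Lemma ucongrb_sym : symmetric ucongrb.
Proof.
by move=> e f; apply/idP/idP => /asboolP h; apply/asboolP; exact: ucongr_sym.
Qed.
Lemma ucongrb_trans : transitive ucongrb.
Proof.
move=> f e h /asboolP ef /asboolP fh; apply/asboolP.
exact: ucongr_trans ef fh.
Qed.

Canonical ucongr_equiv := EquivRel ucongrb ucongrb_refl ucongrb_sym ucongrb_trans.

Definition envalg : Type := {eq_quot ucongr_equiv}.
HB.instance Definition _ := Choice.on envalg.
HB.instance Definition _ := Quotient.on envalg.
HB.instance Definition _ := EqQuotient.on envalg.

Lemma envP (e f : uexpr) : ucongr e f <-> \pi_envalg e = \pi_envalg f.
Proof.
split=> [h|/eqquotP h]; last by apply/asboolP.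
by apply/eqquotP/asboolP.
Qed.

Definition env0 : envalg := \pi_envalg UZero.
Definition env1 : envalg := \pi_envalg UOne.
Definition env_opp (u : envalg) : envalg := \pi_envalg (UOpp (repr u)).
Definition env_add (u v : envalg) : envalg := \pi_envalg (UAdd (repr u) (repr v)).
Definition env_mul (u v : envalg) : envalg := \pi_envalg (UMul (repr u) (repr v)).
Definition env_scale (c : R) (u : envalg) : envalg := \pi_envalg (UScale c (repr u)).

Lemma repr_pi e : ucongr (repr (\pi_envalg e)) e.
Proof. by apply/envP; rewrite reprK. Qed.

Lemma env_oppE e : env_opp (\pi_envalg e) = \pi_envalg (UOpp e).
Proof. by apply/envP/ucongr_opp/repr_pi. Qed.
Lemma env_addE e f : env_add (\pi_envalg e) (\pi_envalg f) = \pi_envalg (UAdd e f).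
Proof. by apply/envP/ucongr_add; exact: repr_pi. Qed.
Lemma env_mulE e f : env_mul (\pi_envalg e) (\pi_envalg f) = \pi_envalg (UMul e f).
Proof. by apply/envP/ucongr_mul; exact: repr_pi. Qed.
Lemma env_scaleE c e : env_scale c (\pi_envalg e) = \pi_envalg (UScale c e).
Proof. by apply/envP/ucongr_scale/repr_pi. Qed.

Let envE := (env_oppE, env_addE, env_mulE, env_scaleE).

Lemma env_ind (P : envalg -> Prop) : (forall e, P (\pi_envalg e)) -> forall u, P u.
Proof. by move=> h u; rewrite -[u]reprK. Qed.

Lemma env_addA : associative env_add.
Proof.
elim/env_ind=> e; elim/env_ind=> f; elim/env_ind=> h; rewrite !envE.
exact/envP/ucongr_addA.
Qed.
Lemma env_addC : commutative env_add.
Proof.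
by elim/env_ind=> e; elim/env_ind=> f; rewrite !envE; exact/envP/ucongr_addC.
Qed.
Lemma env_add0 : left_id env0 env_add.
Proof. by elim/env_ind=> e; rewrite !envE; exact/envP/ucongr_add0. Qed.
Lemma env_addN : left_inverse env0 env_opp env_add.
Proof. by elim/env_ind=> e; rewrite !envE; exact/envP/ucongr_addN. Qed.

HB.instance Definition _ :=
  GRing.isZmodule.Build envalg env_addA env_addC env_add0 env_addN.

Lemma env_mulA : associative env_mul.
Proof.
elim/env_ind=> e; elim/env_ind=> f; elim/env_ind=> h; rewrite !envE.
exact/envP/ucongr_mulA.
Qed.
Lemma env_mul1l : left_id env1 env_mul.
Proof. by elim/env_ind=> e; rewrite !envE; exact/envP/ucongr_mul1l. Qed.
Lemma env_mul1r : right_id env1 env_mul.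
Proof. by elim/env_ind=> e; rewrite !envE; exact/envP/ucongr_mul1r. Qed.
Lemma env_mulDl : left_distributive env_mul +%R.
Proof.
elim/env_ind=> e; elim/env_ind=> f; elim/env_ind=> h.
by rewrite /GRing.add /= !envE; exact/envP/ucongr_mulDl.
Qed.
Lemma env_mulDr : right_distributive env_mul +%R.
Proof.
elim/env_ind=> e; elim/env_ind=> f; elim/env_ind=> h.
by rewrite /GRing.add /= !envE; exact/envP/ucongr_mulDr.
Qed.

Fixpoint uaugment (e : uexpr) : R :=
  match e with
  | UGen _ => 0
  | UZero => 0
  | UOne => 1
  | UOpp e => - uaugment e
  | UAdd e f => uaugment e + uaugment f
  | UMul e f => uaugment e * uaugment f
  | UScale c e => c * uaugment e
  end.

Lemma uaugment_congr e f : ucongr e f -> uaugment e = uaugment f.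
Proof.
elim=> /=.
- by [].
- by move=> ? ? _ ->.
- by move=> ? ? ? _ -> _ ->.
- by move=> ? ? _ ->.
- by move=> ? ? ? ? _ -> _ ->.
- by move=> ? ? ? ? _ -> _ ->.
- by move=> ? ? ? _ ->.
- by move=> *; rewrite addrA.
- by move=> *; rewrite addrC.
- by move=> *; rewrite add0r.
- by move=> *; rewrite addNr.
- by move=> *; rewrite mulrA.
- by move=> *; rewrite mul1r.
- by move=> *; rewrite mulrDr.
- by move=> *; rewrite mulrDl.
- by move=> *; rewrite mulrA.
- by move=> *; rewrite mul1r.
- by move=> *; rewrite mulr1.
- by move=> *; rewrite mulrDl.
- by move=> *; rewrite mulrDr.
- by move=> *; rewrite mulrA.
- by move=> *; rewrite mulrCA.
- by move=> *; rewrite addr0.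
- by move=> *; rewrite mulr0.
- by move=> *; rewrite mulr0 oppr0 addr0.
Qed.

Lemma env1_neq0 : env1 != 0.
Proof.
by apply/eqP => /envP/uaugment_congr /= /eqP; rewrite oner_eq0.
Qed.

HB.instance Definition _ := GRing.Zmodule_isNzRing.Build envalg
  env_mulA env_mul1l env_mul1r env_mulDl env_mulDr env1_neq0.

Lemma env_scaleA c d u : env_scale c (env_scale d u) = env_scale (c * d) u.
Proof.
by elim/env_ind: u => e; rewrite !envE; exact/envP/ucongr_scaleA.
Qed.
Lemma env_scale1 : left_id 1 env_scale.
Proof. by elim/env_ind=> e; rewrite !envE; exact/envP/ucongr_scale1. Qed.
Lemma env_scaleDr : right_distributive env_scale +%R.
Proof.
move=> c; elim/env_ind=> e; elim/env_ind=> f.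
by rewrite /GRing.add /= !envE; exact/envP/ucongr_scaleDr.
Qed.
Lemma env_scaleDl u : {morph env_scale^~ u : c d / c + d}.
Proof.
elim/env_ind: u => e c d.
by rewrite [RHS]/GRing.add /= !envE; exact/envP/ucongr_scaleDl.
Qed.

HB.instance Definition _ := GRing.Zmodule_isLmodule.Build R envalg
  env_scaleA env_scale1 env_scaleDr env_scaleDl.

Lemma env_scaleAl c (u v : envalg) : c *: (u * v) = (c *: u) * v.
Proof.
elim/env_ind: u => e; elim/env_ind: v => f.
by rewrite /GRing.scale /GRing.mul /= !envE; exact/envP/ucongr_scaleAl.
Qed.
Lemma env_scaleAr c (u v : envalg) : c *: (u * v) = u * (c *: v).
Proof.
elim/env_ind: u => e; elim/env_ind: v => f.
by rewrite /GRing.scale /GRing.mul /= !envE; exact/envP/ucongr_scaleAr.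
Qed.

HB.instance Definition _ := GRing.Lmodule_isLalgebra.Build R envalg env_scaleAl.
HB.instance Definition _ := GRing.Lalgebra_isAlgebra.Build R envalg env_scaleAr.

Definition env_gen (a : g) : envalg := \pi_envalg (UGen a).

Lemma env_gen_linear : linear env_gen.
Proof.
move=> c a b; rewrite /env_gen /GRing.add /GRing.scale /= !envE; apply/envP.
apply: ucongr_trans (ucongr_genD _ _) _.
by apply: ucongr_add (ucongr_refl _); exact: ucongr_genZ.
Qed.
HB.instance Definition _ :=
  GRing.isLinear.Build R g envalg *:%R env_gen env_gen_linear.

Lemma env_gen_br a b :
  env_gen (br a b) = env_gen a * env_gen b - env_gen b * env_gen a.
Proof.
rewrite /env_gen /GRing.add /GRing.opp /GRing.mul /= !envE.
exact/envP/ucongr_genB.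
Qed.

Lemma env_mul_ind (P : envalg -> Prop) :
    P 1 -> (forall a u, P u -> P (env_gen a * u)) ->
    (forall c u v, P u -> P v -> P (c *: u + v)) ->
  forall u, P u.
Proof.
move=> P1 Pg Pl u; have P0 : P 0.
  by rewrite -(addNr (1 : envalg)) -scaleN1r; exact: Pl.
suff PM e : forall v, P v -> P (\pi_envalg e * v).
  by elim/env_ind: u => e; rewrite -[X in P X]mulr1; exact: PM.
elim: e => [a||| e IHe|e IHe f IHf|e IHe f IHf|c e IHe] v Pv.
- exact: Pg.
- by rewrite -[\pi_envalg _]/(0 : envalg) mul0r.
- by rewrite -[\pi_envalg _]/(1 : envalg) mul1r.
- rewrite -env_oppE -[env_opp _]/(- \pi_envalg e) mulNr -scaleN1r -[X in P X]addr0.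
  by apply: Pl => //; exact: IHe.
- rewrite -env_addE -[env_add _ _]/(\pi_envalg e + \pi_envalg f) mulrDl.
  by rewrite -[X in P (X + _)]scale1r; apply: Pl; [exact: IHe|exact: IHf].
- rewrite -env_mulE -[env_mul _ _]/(\pi_envalg e * \pi_envalg f) -mulrA.
  exact/IHe/IHf.
- rewrite -env_scaleE -[env_scale _ _]/(c *: \pi_envalg e) -scalerAl.
  by rewrite -[X in P X]addr0; apply: Pl => //; exact: IHe.
Qed.

Section Action.
Variables (W : lmodType R) (act : g -> W -> W).

Fixpoint uexpr_act (e : uexpr) (w : W) : W :=
  match e with
  | UGen a => act a w
  | UZero => 0
  | UOne => w
  | UOpp e => - uexpr_act e w
  | UAdd e f => uexpr_act e w + uexpr_act f w
  | UMul e f => uexpr_act e (uexpr_act f w)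
  | UScale c e => c *: uexpr_act e w
  end.

(* The action of [envalg] on [W] extending an action [act] of [g] on [W] (see
   [env_act1], [env_actM], [env_act_gen], [env_act_linearl]). The lemmas ask the
   action to be linear in [g] and compatible with the bracket only on an
   invariant subspace [good]: [starD] below is an action on all maps T -> U that
   satisfies these identities on the linear ones. *)
Definition env_act (u : envalg) (w : W) : W := uexpr_act (repr u) w.

Variable good : W -> Prop.
Hypothesis actl : forall w, good w -> linear (act^~ w).
Hypothesis actr : forall a, linear (act a).
Hypothesis good_lin : forall c w w', good w -> good w' -> good (c *: w + w').
Hypothesis good_act : forall a w, good w -> good (act a w).
Hypothesis act_br : forall a b w, good w ->
  act (br a b) w = act a (act b w) - act b (act a w).

Let good0 w : good w -> good 0.
Proof. by move=> gw; rewrite -(addNr w) -scaleN1r; exact: good_lin. Qed.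

Lemma uexpr_act_good e w : good w -> good (uexpr_act e w).
Proof.
elim: e w => [a||| e IHe|e IHe f IHf|e IHe f IHf|c e IHe] w gw //=.
- exact: good_act.
- exact: good0 gw.
- by rewrite -scaleN1r -[X in good X]addr0; apply: good_lin; [exact: IHe|exact: good0 gw].
- by rewrite -[X in X + _]scale1r; apply: good_lin; [exact: IHe|exact: IHf].
- exact/IHe/IHf.
- by rewrite -[X in good X]addr0; apply: good_lin; [exact: IHe|exact: good0 gw].
Qed.

Lemma uexpr_act_linear e : linear (uexpr_act e).
Proof.
elim: e => [a||| e IHe|e IHe f IHf|e IHe f IHf|c e IHe] k w w' //=.
- exact: actr.
- by rewrite scaler0 addr0.
- by rewrite IHe opprD scalerN.
- by rewrite IHe IHf scalerDr addrACA.
- by rewrite IHf IHe.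
- by rewrite IHe scalerDr !scalerA mulrC.
Qed.

Let uexpr_actD e w w' : uexpr_act e (w + w') = uexpr_act e w + uexpr_act e w'.
Proof. by have := uexpr_act_linear e 1 w w'; rewrite !scale1r. Qed.
Let uexpr_act0 e : uexpr_act e 0 = 0.
Proof. by apply: (addrI (uexpr_act e 0)); rewrite -uexpr_actD !addr0. Qed.
Let uexpr_actZ e c w : uexpr_act e (c *: w) = c *: uexpr_act e w.
Proof. by have := uexpr_act_linear e c w 0; rewrite !addr0 uexpr_act0 addr0. Qed.
Let act0l w : good w -> act 0 w = 0.
Proof.
move=> gw; have := actl gw 1 0 0; rewrite /= scaler0 addr0 scale1r => h.
by apply: (addrI (act 0 w)); rewrite -h addr0.
Qed.

Lemma uexpr_act_congr e f w :
  ucongr e f -> good w -> uexpr_act e w = uexpr_act f w.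
Proof.
move=> ef; elim: ef w => {e f} /=.
- by [].
- by move=> e f _ IH w gw; rewrite IH.
- by move=> e f h _ IH1 _ IH2 w gw; rewrite IH1 ?IH2.
- by move=> e e' _ IH w gw; rewrite IH.
- by move=> e e' f f' _ IH1 _ IH2 w gw; rewrite IH1 ?IH2.
- move=> e e' f f' _ IH1 _ IH2 w gw; rewrite IH1 ?IH2 //.
  exact: uexpr_act_good.
- by move=> c e e' _ IH w gw; rewrite IH.
- by move=> *; rewrite addrA.
- by move=> *; rewrite addrC.
- by move=> *; rewrite add0r.
- by move=> *; rewrite addNr.
- by move=> *; rewrite scalerA.
- by move=> *; rewrite scale1r.
- by move=> *; rewrite scalerDr.
- by move=> *; rewrite scalerDl.
- by [].
- by [].
- by [].
- by [].
- by move=> *; rewrite uexpr_actD.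
- by [].
- by move=> *; rewrite uexpr_actZ.
- by move=> a b w gw; have := actl gw 1 a b; rewrite /= !scale1r.
- by move=> c a w gw; have := actl gw c a 0; rewrite /= !addr0 act0l ?addr0.
- by move=> a b w gw; exact: act_br.
Qed.

Lemma env_actE e w : good w -> env_act (\pi_envalg e) w = uexpr_act e w.
Proof. by move=> gw; apply: uexpr_act_congr => //; exact: repr_pi. Qed.

Lemma env_act_good u w : good w -> good (env_act u w).
Proof. exact: uexpr_act_good. Qed.

Lemma env_act_linear u : linear (env_act u).
Proof. exact: uexpr_act_linear. Qed.

Lemma env_act_gen a w : good w -> env_act (env_gen a) w = act a w.
Proof. by move=> gw; rewrite env_actE. Qed.

Lemma env_act1 w : good w -> env_act 1 w = w.
Proof. by move=> gw; rewrite env_actE. Qed.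

Lemma env_actM u v w : good w -> env_act (u * v) w = env_act u (env_act v w).
Proof.
move=> gw; elim/env_ind: u => e; elim/env_ind: v => f.
rewrite /GRing.mul /= env_mulE !env_actE //; exact: uexpr_act_good.
Qed.

Lemma env_act_linearl w : good w -> linear (env_act^~ w).
Proof.
move=> gw c; elim/env_ind=> e; elim/env_ind=> f.
by rewrite [in LHS]/GRing.add [in LHS]/GRing.scale /= !envE !env_actE.
Qed.

End Action.
End Enveloping.

Section UniversalProperty.
Variables (R : comNzRingType) (g : lmodType R) (br : g -> g -> g).
Variables (A : algType R) (f : {linear g -> A}).

Lemma envalg_lift : (forall a b, f (br a b) = f a * f b - f b * f a) ->
  exists F : {lrmorphism envalg br -> A}, forall a, F (env_gen br a) = f a.
Proof.
move=> f_br; pose act (a : g) (x : A) := f a * x; pose good (x : A) := True.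
have actl x : good x -> linear (act^~ x).
  by move=> _ c a b; rewrite /act linearP mulrDl scalerAl.
have actr a : linear (act a).
  by move=> c x y; rewrite /act mulrDr scalerAr.
have act_br a b x : good x -> act (br a b) x = act a (act b x) - act b (act a x).
  by move=> _; rewrite /act f_br mulrBl !mulrA.
have gl : forall (c : R) (x y : A), good x -> good y -> good (c *: x + y) by [].
have ga : forall a x, good x -> good (act a x) by [].
pose F (u : envalg br) : A := env_act act u 1.
have Fmul u x : env_act act u x = F u * x.
  elim/env_mul_ind: u x => [|a u IH|c u v IHu IHv] x.
  - by rewrite /F !(env_act1 actl actr gl ga act_br) // mul1r.
  - rewrite /F !(env_actM actl actr gl ga act_br) //.
    by rewrite !(env_act_gen actl actr gl ga act_br) // IH /act mulrA.
  - rewrite /F !(env_act_linearl actl actr gl ga act_br) //.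
    by rewrite IHu IHv mulrDl scalerAl.
have F_lin : linear F.
  by move=> c u v; rewrite /F (env_act_linearl actl actr gl ga act_br).
have F_mul : {morph F : u v / u * v}.
  by move=> u v; rewrite -Fmul -(env_actM actl actr gl ga act_br).
have F_1 : F 1 = 1 by rewrite /F (env_act1 actl actr gl ga act_br).
pose LF := GRing.isLinear.Build R (envalg br) A *:%R F F_lin.
pose MF := GRing.isMonoidMorphism.Build (envalg br) A F (F_1, F_mul).
pose LRF : {lrmorphism envalg br -> A} := HB.pack F LF MF.
by exists LRF => a; rewrite /= /F (env_act_gen actl actr gl ga act_br) // /act mulr1.
Qed.

Lemma envalg_lift_uniq (F G : {lrmorphism envalg br -> A}) :
  (forall a, F (env_gen br a) = G (env_gen br a)) -> F =1 G.
Proof.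
move=> FG; elim/env_mul_ind => [|a u IH|c u v IHu IHv].
- by rewrite !rmorph1.
- by have -> : F (env_gen br a * u) = F (env_gen br a) * F u
    by [exact: rmorphM]; rewrite IH FG -rmorphM.
- by have -> : F (c *: u + v) = c *: F u + F v by [exact: linearP];
    rewrite IHu IHv -linearP.
Qed.

End UniversalProperty.

(* M(L x N), with [L] the finite set of labels. [cmonom S] is the type of finitely
   supported functions S -> nat; monalg writes it multiplicatively, so [mulcm] is
   the sum of multi-indices, [onecm] the zero multi-index, [ucm s] is e_s and
   [divcm] the truncated difference. *)
Notation mindex L := (cmonom (L * nat)%type).
(* The polynomial algebra R[z_(l,k)]. *)
Notation zalg R L := (malg (mindex L) R).

Section Leibniz.
Variables (R : comNzRingType) (A : comAlgType R) (d : A -> A).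
Hypothesis d_lin : linear d.

Let leibniz p q := d (p * q) = d p * q + p * d q.

Lemma leibniz_linl c p p' q :
  leibniz p q -> leibniz p' q -> leibniz (c *: p + p') q.
Proof.
rewrite /leibniz => h h'; rewrite mulrDl -scalerAl !d_lin h h' !mulrDl.
by rewrite -!scalerAl scalerDr addrACA.
Qed.

Lemma leibniz_linr c p q q' :
  leibniz p q -> leibniz p q' -> leibniz p (c *: q + q').
Proof.
rewrite /leibniz => h h'; rewrite mulrDr -scalerAr !d_lin h h' !mulrDr.
by rewrite -!scalerAr scalerDr addrACA.
Qed.

Lemma scale_leibniz (c : R) (z p q p' q' : A) :
  c *: (z * (p' * q + p * q')) = c *: (z * p') * q + p * (c *: (z * q')).
Proof. by rewrite mulrDr scalerDr -scalerAl -scalerAr mulrA (mulrCA p). Qed.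

Lemma leibniz_preLie (p q r : A) : (forall p q, leibniz p q) ->
  (p * d q - q * d p) * d r = p * d (q * d r) - q * d (p * d r).
Proof.
rewrite /leibniz => dM; rewrite !dM mulrBl !mulrDr !mulrA (mulrC q p).
by rewrite opprD addrACA subrr addr0.
Qed.

End Leibniz.

Section PreLie.
Variables (R : realType) (L : finType).
Implicit Types (b : mindex L) (v : L * nat) (p q : zalg R L).

Definition zmon b : zalg R L := mkmalgU b 1.
Definition zgen v : zalg R L := zmon (ucm v).

(* [beta] *)
Definition weight b : int :=
  \sum_(v <- finsupp b) (1 - v.2%:Z) * (b v)%:Z.

Definition partialz v p : zalg R L :=
  \sum_(b <- msupp p) (mcoeff b p * (b v)%:R) *: zmon (divcm b (ucm v)).

(* The sum over all (l, k) has finitely many nonzero terms ([derivDEw]); here and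
   below [\sum_(i \in A)] is the sum over a set of a family with finite support. *)
Definition derivD p : zalg R L :=
  \sum_(v \in [set: L * nat]) v.2.+1%:R *: (zgen (v.1, v.2.+1) * partialz v p).

Definition homogz (d : int) p : bool := all (fun b => weight b == d) (msupp p).

Lemma homogP d p :
  reflect (forall b, mcoeff b p != 0 -> weight b = d) (homogz d p).
Proof.
apply: (iffP allP) => h b; first by rewrite mcoeff_neq0 => /h/eqP.
by rewrite -mcoeff_neq0 => /h ->.
Qed.

Lemma homog_linear d c p q : homogz d p -> homogz d q -> homogz d (c *: p + q).
Proof.
move=> /homogP hp /homogP hq; apply/homogP => b.
rewrite mcoeffD mcoeffZ; have [->|/hp//] := eqVneq (mcoeff b p) 0.
by rewrite mulr0 add0r; exact: hq.
Qed.

Lemma homog0 d : homogz d 0.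
Proof. by apply/homogP => b; rewrite mcoeff0 eqxx. Qed.

Lemma homog_sum d (I : Type) (r : seq I) (P : pred I) F :
  (forall i, P i -> homogz d (F i)) -> homogz d (\sum_(i <- r | P i) F i).
Proof.
move=> h; apply: (big_ind (homogz d)) => //; first exact: homog0.
by move=> p q hp hq; rewrite -[p]scale1r; exact: homog_linear.
Qed.

Lemma weightEw b (A : {fset L * nat}) : {subset finsupp b <= A} ->
  weight b = \sum_(v <- A) (1 - v.2%:Z) * (b v)%:Z.
Proof.
move=> bA; rewrite /weight; apply: big_fset_incl => [|v _ vb].
  exact/fsubsetP.
by rewrite fsfun_dflt // mulr0.
Qed.

Lemma weightM b b' : weight (mulcm b b') = weight b + weight b'.
Proof.
pose A := (finsupp b `|` finsupp b')%fset.
have sl : {subset finsupp b <= A} by move=> v vb; rewrite in_fsetU vb.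
have sr : {subset finsupp b' <= A} by move=> v vb; rewrite in_fsetU vb orbT.
have sM : {subset finsupp (mulcm b b') <= A}.
  move=> v; rewrite -cmE_neq0 mulcmE addn_eq0 negb_and !cmE_neq0 => vb.
  by rewrite in_fsetU.
rewrite (weightEw sl) (weightEw sr) (weightEw sM).
rewrite -big_split /=; apply: eq_bigr => v _.
by rewrite mulcmE PoszD mulrDr.
Qed.

Lemma weightU v : weight (ucm v) = 1 - v.2%:Z.
Proof. by rewrite /weight mdomU big_seq_fset1 cmUU mulr1. Qed.

Lemma divcmK b v : b v != 0%N -> mulcm (divcm b (ucm v)) (ucm v) = b.
Proof.
move=> bv; apply/eqP/cmP => w; rewrite mulcmE divcmE ucmE.
by case: eqVneq => [<-|_] /=; rewrite ?subn0 ?addn0 // subnK // lt0n.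
Qed.

Lemma homogM d d' p q : homogz d p -> homogz d' q -> homogz (d + d') (p * q).
Proof.
move=> /homogP hp /homogP hq; apply/homogP => b.
rewrite mcoeff_neq0 => /msuppM_le [b1 [b2 [h1 h2 ->]]].
by rewrite -[mul _ _]/(mulcm b1 b2) weightM hp ?hq ?mcoeff_neq0.
Qed.

Lemma homog_zmon b : homogz (weight b) (zmon b).
Proof.
apply/homogP => b'; rewrite mcoeffU1.
by have [->|_] := eqVneq b b'; rewrite ?eqxx.
Qed.

Lemma homogZ d c p : homogz d p -> homogz d (c *: p).
Proof. by move=> h; rewrite -[_ *: _]addr0; apply: homog_linear; rewrite ?homog0. Qed.

Lemma homog_partial d v p :
  homogz d p -> homogz (d - (1 - v.2%:Z)) (partialz v p).
Proof.
move=> /homogP hp; rewrite /partialz big_seq; apply: homog_sum => b bp.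
have [->|bv] := eqVneq (b v) 0%N; first by rewrite mulr0 scale0r homog0.
apply: homogZ; rewrite -(hp b) ?mcoeff_neq0 //.
rewrite -[in X in homogz (X - _)](divcmK bv) weightM weightU addrK.
exact: homog_zmon.
Qed.

Lemma homog_derivD d p : homogz d p -> homogz (d - 1) (derivD p).
Proof.
move=> hp; rewrite /derivD; apply: homog_sum => v _; apply: homogZ.
have -> : d - 1 = weight (ucm (v.1, v.2.+1)) + (d - (1 - v.2%:Z)).
  by rewrite weightU /= intS; ring.
by apply: homogM; [exact: homog_zmon|exact: homog_partial].
Qed.

Lemma partialzEw v p (A : {fset mindex L}) : {subset msupp p <= A} ->
  partialz v p =
  \sum_(b <- A) (mcoeff b p * (b v)%:R) *: zmon (divcm b (ucm v)).
Proof.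
move=> pA; apply: big_fset_incl => [|b _ bp]; first exact/fsubsetP.
by rewrite mcoeff_outdom // mul0r scale0r.
Qed.

Lemma partialz_linear v : linear (partialz v).
Proof.
move=> c p q; pose A := (msupp p `|` msupp q)%fset.
have sl : {subset msupp p <= A} by move=> b h; rewrite in_fsetU h.
have sr : {subset msupp q <= A} by move=> b h; rewrite in_fsetU h orbT.
have sM : {subset msupp (c *: p + q) <= A}.
  move=> b; rewrite -mcoeff_neq0 mcoeffD mcoeffZ in_fsetU -!mcoeff_neq0.
  by apply: contraR; rewrite negb_or !negbK => /andP[/eqP-> /eqP->];
    rewrite mulr0 addr0.
rewrite (partialzEw v sl) (partialzEw v sr) (partialzEw v sM).
rewrite scaler_sumr -big_split /=; apply: eq_bigr => b _.
by rewrite mcoeffD mcoeffZ mulrDl scalerDl scalerA mulrA.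
Qed.

HB.instance Definition _ v :=
  GRing.isLinear.Build R (zalg R L) (zalg R L) *:%R (partialz v)
    (partialz_linear v).

Lemma partialz_zmon v b : partialz v (zmon b) = (b v)%:R *: zmon (divcm b (ucm v)).
Proof. by rewrite /partialz msuppU1 big_seq_fset1 mcoeffUU mul1r. Qed.

Lemma zmonM b b' : zmon b * zmon b' = zmon (mulcm b b').
Proof. by rewrite /zmon malgM_def fgmulUU mulr1. Qed.

Lemma zalgE p : p = \sum_(b <- msupp p) mcoeff b p *: zmon b.
Proof.
rewrite [LHS]monalgE; apply: eq_bigr => b _.
apply/malgP => b'; rewrite /zmon mcoeffZ [LHS]mcoeffU [X in _ * X]mcoeffU.
by case: (b == b'); rewrite ?mulr1n ?mulr1 ?mulr0n ?mulr0.
Qed.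

(* Stated for an abstract [zm], so that unification does not unfold [zmon]. *)
Let partialzM_mon v (zm dz : mindex L -> zalg R L) :
    (forall b b', zm b * zm b' = zm (mulcm b b')) ->
    (forall b, dz b = (b v)%:R *: zm (divcm b (ucm v))) ->
  forall b b', dz (mulcm b b') = dz b * zm b' + zm b * dz b'.
Proof.
have auxl (n n' : nat) : n != 0%N -> (n + n' - 1 = n - 1 + n')%N.
  by move=> n0; rewrite addnBAC // lt0n.
have auxr (n n' : nat) : n' != 0%N -> (n + n' - 1 = n + (n' - 1))%N.
  by move=> n0; rewrite addnBA // lt0n.
move=> zmM dzE b b'; rewrite !dzE mulcmE natrD scalerDl -scalerAl -scalerAr !zmM.
have El : (b v)%:R *: zm (divcm (mulcm b b') (ucm v))
    = (b v)%:R *: zm (mulcm (divcm b (ucm v)) b').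
  have [->|bv] := eqVneq (b v) 0%N; first by rewrite !scale0r.
  suff E : divcm (mulcm b b') (ucm v) = mulcm (divcm b (ucm v)) b'.
    exact: (congr1 (fun m => (b v)%:R *: zm m) E).
  apply/eqP/cmP => w; rewrite !(mulcmE, divcmE) ucmE.
  have [<-|_] := eqVneq v w; last by rewrite /= !subn0.
  exact: auxl bv.
have Er : (b' v)%:R *: zm (divcm (mulcm b b') (ucm v))
    = (b' v)%:R *: zm (mulcm b (divcm b' (ucm v))).
  have [->|bv] := eqVneq (b' v) 0%N; first by rewrite !scale0r.
  suff E : divcm (mulcm b b') (ucm v) = mulcm b (divcm b' (ucm v)).
    exact: (congr1 (fun m => (b' v)%:R *: zm m) E).
  apply/eqP/cmP => w; rewrite !(mulcmE, divcmE) ucmE.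
  have [<-|_] := eqVneq v w; last by rewrite /= !subn0.
  exact: auxr bv.
exact: (@f_equal2 _ _ _ +%R _ _ _ _ El Er).
Qed.

Lemma zalg_ind (Q : zalg R L -> Prop) :
    (forall b, Q (zmon b)) -> Q 0 ->
    (forall c p q, Q p -> Q q -> Q (c *: p + q)) ->
  forall p, Q p.
Proof.
move=> Qm Q0 Ql p; rewrite [p]zalgE; elim: (enum_fset _) => [|b r IH].
  by rewrite big_nil.
by rewrite big_cons; apply: Ql.
Qed.

Lemma partialzM v p q :
  partialz v (p * q) = partialz v p * q + p * partialz v q.
Proof.
elim/zalg_ind: p => [b||c p1 p2 IH1 IH2]; last 1 first.
- exact (@leibniz_linl _ (zalg R L) _ (partialz_linear v) c p1 p2 q IH1 IH2).
- elim/zalg_ind: q => [b'||c q1 q2 IH1 IH2]; last 1 first.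
  + exact (@leibniz_linr _ (zalg R L) _ (partialz_linear v) c (zmon b) q1 q2 IH1 IH2).
  + rewrite zmonM.
    exact: (partialzM_mon (dz := fun b => partialz v (zmon b)) zmonM
              (partialz_zmon v)).
  + by rewrite mulr0 linear0 !mulr0 addr0.
- by rewrite mul0r linear0 !mul0r addr0.
Qed.

Definition zvars p : seq (L * nat) :=
  undup (flatten [seq enum_fset (finsupp b) | b <- enum_fset (msupp p)]).

Lemma partialz_out v p : v \notin zvars p -> partialz v p = 0.
Proof.
move=> vp; rewrite /partialz big_seq big1 // => b bp.
have -> : b v = 0%N; last by rewrite mulr0 scale0r.
apply/eqP; rewrite cmE_eq0; apply: contra vp => vb.
by rewrite mem_undup; apply/flatten_mapP; exists b.
Qed.

Lemma derivDEw p (r : seq (L * nat)) : uniq r -> {subset zvars p <= r} ->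
  derivD p =
  \sum_(v <- r) v.2.+1%:R *: (zgen (v.1, v.2.+1) * partialz v p).
Proof.
move=> ur pr; rewrite /derivD (fsbigE r) //=.
  by apply: eq_bigl => v; rewrite in_setT.
move=> v _ vr; rewrite partialz_out ?mulr0 ?scaler0 //.
by apply: contra vr; exact: pr.
Qed.

Lemma derivD_linear : linear derivD.
Proof.
move=> c p q; pose r := undup (zvars p ++ zvars q ++ zvars (c *: p + q)).
have ur : uniq r := undup_uniq _.
have rp : {subset zvars p <= r}.
  by move=> v vp; rewrite mem_undup !mem_cat vp.
have rq : {subset zvars q <= r}.
  by move=> v vq; rewrite mem_undup !mem_cat vq orbT.
have rs : {subset zvars (c *: p + q) <= r}.
  by move=> v vs; rewrite mem_undup !mem_cat vs !orbT.
rewrite (derivDEw ur rp) (derivDEw ur rq) (derivDEw ur rs).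
rewrite scaler_sumr -big_split /=; apply: eq_bigr => v _.
by rewrite linearP /= mulrDr scalerDr -scalerAr !scalerA mulrC.
Qed.

HB.instance Definition _ :=
  GRing.isLinear.Build R (zalg R L) (zalg R L) *:%R derivD derivD_linear.

Lemma derivDM p q : derivD (p * q) = derivD p * q + p * derivD q.
Proof.
pose r := undup (zvars p ++ zvars q ++ zvars (p * q)).
have ur : uniq r := undup_uniq _.
have rp : {subset zvars p <= r}.
  by move=> v vp; rewrite mem_undup !mem_cat vp.
have rq : {subset zvars q <= r}.
  by move=> v vq; rewrite mem_undup !mem_cat vq orbT.
have rs : {subset zvars (p * q) <= r}.
  by move=> v vs; rewrite mem_undup !mem_cat vs !orbT.
rewrite (derivDEw ur rp) (derivDEw ur rq) (derivDEw ur rs).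
rewrite mulr_suml mulr_sumr -big_split /=; apply: eq_bigr => v _.
rewrite (partialzM v p q); exact: (scale_leibniz (A := zalg R L)).
Qed.

End PreLie.

Section TSpace.
Variables (R : realType) (L : finType).

Definition homog1 : {pred zalg R L} := homogz 1.
Lemma homog1_closed : submod_closed homog1.
Proof.
split; first exact: homog0.
by move=> c p q hp hq; exact: homog_linear.
Qed.
HB.instance Definition _ :=
  GRing.isSubmodClosed.Build R (zalg R L) homog1 homog1_closed.

(* span {z^beta : [beta] = 1}, as the polynomials supported on such monomials *)
Record Tspace : Type := MkT { Tval : zalg R L; TvalP : Tval \in homog1 }.
HB.instance Definition _ := [isSub for Tval].
HB.instance Definition _ := [Choice of Tspace by <:].
HB.instance Definition _ := [SubChoice_isSubLmodule of Tspace by <:].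

Lemma preLie_subproof (a b : Tspace) : Tval a * derivD (Tval b) \in homog1.
Proof.
have -> : (homog1 : {pred _}) = homogz (1 + (1 - 1)) by rewrite subrr addr0.
by apply: homogM; [exact: (TvalP a)|apply: homog_derivD; exact: (TvalP b)].
Qed.
(* a D b = a * (D b) *)
Definition preLie (a b : Tspace) : Tspace := MkT (preLie_subproof a b).
Definition Tbracket (a b : Tspace) : Tspace := preLie a b - preLie b a.
End TSpace.

Section PreLieTheory.
Variables (R : realType) (L : finType).
Local Notation T := (Tspace R L).
Implicit Types (a b c x y : T) (k : R).

Lemma preLie_linearl b : linear (fun a => preLie a b).
Proof.
move=> k a a'; apply: val_inj; rewrite /=.
by rewrite mulrDl -scalerAl.
Qed.

Lemma preLie_linearr a : linear (preLie a).
Proof.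
move=> k b b'; apply: val_inj; rewrite /=.
by rewrite (derivD_linear k (Tval b) (Tval b')) mulrDr -scalerAr.
Qed.

Lemma preLie_bracket a b c :
  preLie (Tbracket a b) c = preLie a (preLie b c) - preLie b (preLie a c).
Proof.
apply: val_inj.
exact (leibniz_preLie (A := zalg R L) (Tval a) (Tval b) (Tval c)
  (@derivDM R L)).
Qed.

End PreLieTheory.

Notation Uenv R L := (envalg (@Tbracket R L)).

Section Star.
Variables (R : realType) (L : finType).
Local Notation T := (Tspace R L).
Local Notation U := (Uenv R L).
Local Notation gen := (env_gen (@Tbracket R L)).
Implicit Types (a b c : T) (u v : U) (k : R).

(* rho_D as a curried map U(T, D) -> End(T): [rhoD_linearr], [rhoD_linearl],
   [rhoD1], [rhoDM], [rhoD_gen] say that it takes linear values, is a morphism of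
   algebras, and extends [preLie]. *)
Definition rhoD (u : U) : T -> T := env_act (@preLie R L) u.

Let goodT (a : T) := True.
Let goodT_lin k (a b : T) : goodT a -> goodT b -> goodT (k *: a + b).
Proof. by []. Qed.
Let goodT_act (a b : T) : goodT b -> goodT (preLie a b).
Proof. by []. Qed.
Let preLie_l a : goodT a -> linear ((@preLie R L)^~ a).
Proof. by move=> _; exact: preLie_linearl. Qed.
Let preLie_br a b c : goodT c ->
  preLie (Tbracket a b) c = preLie a (preLie b c) - preLie b (preLie a c).
Proof. by move=> _; exact: preLie_bracket. Qed.

Lemma rhoD_linearr u : linear (rhoD u).
Proof. exact: (env_act_linear (@preLie_linearr R L)). Qed.

Lemma rhoD_linearl a : linear (rhoD^~ a).
Proof.
exact: (env_act_linearl preLie_l (@preLie_linearr R L) goodT_lin goodT_act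
  preLie_br).
Qed.

Lemma rhoD1 a : rhoD 1 a = a.
Proof.
exact: (env_act1 preLie_l (@preLie_linearr R L) goodT_lin goodT_act
  preLie_br).
Qed.

Lemma rhoDM u v a : rhoD (u * v) a = rhoD u (rhoD v a).
Proof.
exact: (env_actM preLie_l (@preLie_linearr R L) goodT_lin goodT_act
  preLie_br).
Qed.

Lemma rhoD_gen a b : rhoD (gen a) b = preLie a b.
Proof.
exact: (env_act_gen preLie_l (@preLie_linearr R L) goodT_lin goodT_act
  preLie_br).
Qed.

(* For fixed u, the map phi = (a |-> u *_D a) : T -> U has to satisfy
   (a'u) *_D a = a' phi(a) - phi(a' D a), with phi = the inclusion of T for u = 1.
   This is an action of T on maps T -> U, which extends to U and gives [starD];
   its defining equations are [starD1] and [starD_genM]. *)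
Definition star_act (a : T) (phi : T -> U) : T -> U :=
  fun b => gen a * phi b - phi (preLie a b).

Definition starD (u : U) (a : T) : U := env_act star_act u gen a.

Let goodS (phi : T -> U) : Prop := linear phi.

Let star_actl (phi : T -> U) : goodS phi -> linear (star_act^~ phi).
Proof.
move=> h k a a'; apply/funext => b; rewrite /star_act.
rewrite (preLie_linearl b k a a') h linearP mulrDl -scalerAl.
by rewrite opprD addrACA -scalerBr.
Qed.

Let star_actr a : linear (star_act a).
Proof.
move=> k phi psi; apply/funext => b; rewrite /star_act /=.
rewrite mulrDr -scalerAr opprD addrACA.
by rewrite -scalerBr.
Qed.

Let star_good_lin k (phi psi : T -> U) :
  goodS phi -> goodS psi -> goodS (k *: phi + psi).
Proof.
move=> hp hq c a b; rewrite /= -![(_ + _) _]/(k *: phi _ + psi _).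
by rewrite hp hq !scalerDr !scalerA (mulrC c) addrACA.
Qed.

Let star_good_act a (phi : T -> U) : goodS phi -> goodS (star_act a phi).
Proof.
move=> h k b b'; rewrite /star_act (preLie_linearr a k b b') !h mulrDr scalerBr.
by rewrite scalerAr opprD addrACA.
Qed.

Let star_br a b (phi : T -> U) : goodS phi ->
  star_act (Tbracket a b) phi
  = star_act a (star_act b phi) - star_act b (star_act a phi).
Proof.
move=> h; apply/funext => c; rewrite -[(_ - _) c]/(_ c - _ c).
have hB x y : phi (x - y) = phi x - phi y.
  by rewrite addrC -scaleN1r h scaleN1r addrC.
rewrite /star_act preLie_bracket env_gen_br hB.
have E (x y z w : U) : x - y - (z - w) = (x + w) - (y + z).
  by rewrite opprB opprD !addrA (addrAC x).
rewrite mulrBl !mulrBr !mulrA.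
move: (gen a * gen b * _) (gen b * gen a * _) => u u'.
move: (gen a * _) (gen b * _) (phi _) (phi _) => p q r r'.
rewrite [LHS]E [in RHS]E addrA subrK [q - _ + _]addrC addrA subrK E.
by rewrite [r' + _]addrC.
Qed.

Let gen_linear : goodS gen := env_gen_linear (@Tbracket R L).

Lemma starD_linearl a : linear (starD^~ a).
Proof.
move=> k u v; rewrite /starD.
by rewrite (@env_act_linearl _ _ _ _ _ goodS star_actl star_actr star_good_lin
  star_good_act star_br _ gen_linear).
Qed.

Lemma starD_linearr u : linear (starD u).
Proof.
exact: (@env_act_good R T (@Tbracket R L) (T -> U) star_act goodS star_good_lin
  star_good_act u gen gen_linear).
Qed.

Lemma starD1 a : starD 1 a = gen a.
Proof.
by rewrite /starD (@env_act1 _ _ _ _ _ goodS star_actl star_actr star_good_lin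
  star_good_act star_br _ gen_linear).
Qed.

Lemma starD_genM b u a :
  starD (gen b * u) a = gen b * starD u a - starD u (preLie b a).
Proof.
have gu : goodS (env_act star_act u gen).
  exact: (@env_act_good R T (@Tbracket R L) (T -> U) star_act goodS
    star_good_lin star_good_act u gen gen_linear).
rewrite /starD (@env_actM _ _ _ _ _ goodS star_actl star_actr star_good_lin
  star_good_act star_br _ _ _ gen_linear).
by rewrite (@env_act_gen _ _ _ _ _ goodS star_actl star_actr star_good_lin
  star_good_act star_br _ _ gu).
Qed.

Lemma starDC u a b : starD (starD u a) b = starD (starD u b) a.
Proof.
have lB x y z : starD (x - y) z = starD x z - starD y z.
  by rewrite addrC -scaleN1r (starD_linearl z (-1) y x) scaleN1r addrC.
elim/env_mul_ind: u a b => [|c u IH|k u v IHu IHv] a b.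
- have gE x y : starD (gen x) y = gen x * gen y - gen (preLie x y).
    by rewrite -[gen x]mulr1 starD_genM !starD1 mulr1.
  rewrite !starD1 !gE.
  have /eqP := env_gen_br (@Tbracket R L) a b.
  rewrite /Tbracket raddfB /= subr_eq => /eqP ->.
  by rewrite opprD opprB addrA [_ + (_ - _)]addrC subrK.
- rewrite !starD_genM !lB !starD_genM (IH a b) (IH (preLie c a) b).
  by rewrite (IH (preLie c b) a) addrAC.
- by rewrite !(starD_linearl _ k u v) !(starD_linearl _ k) IHu IHv.
Qed.

End Star.

(* The index set {beta : [beta] = 1} of the monomials of T, and T^* as the space
   of all families of coefficients on it. *)
Notation Tindex L := {b : cmonom (L * nat)%type | weight b == 1}.
Notation Tstar R L := (Tindex L -> R).

Definition mindex_sum (L : finType) (s : seq (mindex L)) : mindex L :=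
  \big[@mulcm _/onecm _]_(b <- s) b.

Section Exponential.
Variables (R : realType) (L : finType).
Local Notation T := (Tspace R L).
Local Notation U := (Uenv R L).

Lemma Tmon_subproof (b : Tindex L) :
  zmon R (val b) \in @homog1 R L.
Proof. by have := homog_zmon R (val b); rewrite (eqP (valP b)). Qed.
Definition Tmon (b : Tindex L) : T := MkT (Tmon_subproof b).

Definition starDs (u : U) (s : seq (Tindex L)) : U :=
  foldl (fun w b => starD w (Tmon b)) u s.

Definition mfact (I : cmonom (Tindex L)) : nat :=
  (\prod_(b <- finsupp I) (I b)`!)%N.

Definition mlist (I : cmonom (Tindex L)) : seq (Tindex L) :=
  flatten [seq nseq (I b) b | b <- enum_fset (finsupp I)].

(* Z_I, computed along the enumeration [mlist I] of I with multiplicities; by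
   [ZbasisE] any other enumeration gives the same element. *)
Definition Zbasis (I : cmonom (Tindex L)) : U :=
  (mfact I)%:R^-1 *: starDs 1 (mlist I).

Lemma starDs_cat u s s' : starDs u (s ++ s') = starDs (starDs u s) s'.
Proof. exact: foldl_cat. Qed.

Lemma starDs_starD u a s : starDs (starD u a) s = starD (starDs u s) a.
Proof. by elim: s u => //= b s IH u; rewrite -IH starDC. Qed.

Lemma starDsC u s s' : starDs (starDs u s) s' = starDs (starDs u s') s.
Proof.
by elim: s u => //= b s IH u; rewrite IH starDs_starD.
Qed.

Lemma starDs_perm u s s' : perm_eq s s' -> starDs u s = starDs u s'.
Proof.
apply: (catCA_perm_subst (F := starDs u)) => s1 s2 s3.
by rewrite !starDs_cat (starDsC u s1 s2).
Qed.

Lemma count_mlist (I : cmonom (Tindex L)) b : count_mem b (mlist I) = I b.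
Proof.
rewrite /mlist count_flatten -map_comp sumnE big_map.
have [bI|bI] := boolP (b \in finsupp I).
  rewrite (big_fsetD1 b) //= count_nseq /= eqxx mul1n big1_fset ?addn0 //.
  by move=> c; rewrite in_fsetD1 => /andP[cb _] _;
    rewrite /= count_nseq /= (negbTE cb).
rewrite (fsfun_dflt bI) big1_fset // => c cI _; rewrite /= count_nseq /=.
by have [cb|_] := eqVneq c b; rewrite ?mul0n //; rewrite -cb cI in bI.
Qed.

Lemma ZbasisE (I : cmonom (Tindex L)) (s : seq (Tindex L)) :
  (forall b, I b = count_mem b s) ->
  Zbasis I = (mfact I)%:R^-1 *: starDs 1 s.
Proof.
move=> Is; congr (_ *: _); apply: starDs_perm.
by apply/allP => b _; rewrite /= count_mlist Is.
Qed.

(* The coefficient f_beta for an arbitrary multi-index: 0 unless [beta] = 1. *)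
Definition coefT (f : Tstar R L) (b : mindex L) : R :=
  if insub b is Some c then f c else 0.

Definition toTstar (a : T) : Tstar R L := fun c => mcoeff (val c) (Tval a).

(* The componentwise extension of rho_D(u) to T^*. *)
Definition rhoD_star (u : U) (p : Tstar R L) : Tstar R L :=
  fun c => \sum_(b \in [set: Tindex L]) p b * toTstar (rhoD u (Tmon b)) c.

(* A formal sum sum_I F_I Z_I is represented by its coefficients
   F : M(T) -> R, the Z_I being a basis of U(T, D); exp_D(f) has F_I = f^I. *)
Definition expD (f : Tstar R L) : cmonom (Tindex L) -> R :=
  fun I => \prod_(b <- finsupp I) f b ^+ I b.

Definition rhoD_series (F : cmonom (Tindex L) -> R) (p : Tstar R L) :
    Tstar R L :=
  fun c => \sum_(I \in [set: cmonom (Tindex L)]) F I * rhoD_star (Zbasis I) p c.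

(* z_(l,0) *)
Lemma Tgen0_subproof (l : L) : weight (ucm (l, 0%N)) == 1.
Proof. by rewrite weightU /= subr0. Qed.
Definition Tgen0 (l : L) : T :=
  Tmon (exist (fun b : mindex L => is_true (weight b == 1))
          (ucm (l, 0%N)) (Tgen0_subproof l)).

End Exponential.

Section Integration.
Variable (R : realType).

(* Smoothness on the closed interval [0, 1], for functions given on R whose values
   outside [0, 1] are irrelevant. *)
Definition smooth01 (f : R -> R) : Prop :=
  exists g : R -> R,
    (forall n x, derivable (derive1n n g) x 1) /\
    (forall x, 0 <= x <= 1 -> f x = g x).

(* int_s^t f dX = int_s^t f X' du, oriented. Only the values of X' on the open
   interval matter, hence only X on the closed one. *)
Definition dint_integrable (X f : R -> R) (s t : R) : Prop :=
  (@lebesgue_measure R).-integrable `[Num.min s t, Num.max s t]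
    (EFin \o (fun u => f u * derive1 X u)).

Definition dint (X f : R -> R) (s t : R) : R :=
  if s <= t then \int[@lebesgue_measure R]_(u in `[s, t]) (f u * derive1 X u)
  else - \int[@lebesgue_measure R]_(u in `[t, s]) (f u * derive1 X u).

Definition dintT (L : finType) (X : R -> R) (F : R -> Tstar R L) (s t : R) :
    Tstar R L :=
  fun c => dint X (fun u => F u c) s t.

End Integration.

(* Main.v *)
Require Import Defs.
From HB Require Import structures.
From mathcomp Require Import all_boot all_order all_algebra finmap.
From mathcomp Require Import all_classical all_reals all_analysis.
From mathcomp Require Import -(notations) monalg.
Set Implicit Arguments.
Unset Strict Implicit.
Unset Printing Implicit Defensive.
Import Order.TTheory GRing.Theory Num.Theory.
Local Open Scope classical_set_scope.
Local Open Scope ring_scope.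

(** Both equations express [x s t] as a sum of integrals, and the two sums are
    equal componentwise for every [x] for which the integrals of the hierarchy
    make sense; the equivalence follows.

    The algebraic core is a closed formula for the operators [rhoD (Zbasis I)].
    Each [rhoD u] is a differential operator [sum_n p_n D^n], which makes sense
    on the whole polynomial algebra ([diff_op]), and the recursion defining the
    product [starD] is the one satisfied by the operation
    [sum_n p_n D^n |-> sum_n (p_n a) D^(n+1)], by the Leibniz rule. Hence
    [diff_op (starD u a) w = a * diff_op u (D w)] ([diff_op_starD]), and
    [rho_D(Z_I) z_(l,0) = (1/I!) z^(sum I) D^k z_(l,0)], where k is the total
    multiplicity of I. Since [D^k z_(l,0) = k! z_(l,k)], the component at [c] of
    this vector is [k!/I!] if [e_(l,k) + sum I = c], and 0 otherwise
    ([rhoD_Zbasis_coef]).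

    The multinomial coefficient [k!/I!] counts the orderings of the multiset I
    ([size_permutations_count]), so summing [f^I rho_D(Z_I) z_(l,0)] over
    multisets I is the same as summing the products [f_(b_1) ... f_(b_k)] over
    ordered tuples with [e_(l,k) + b_1 + ... + b_k = c] ([rhoD_series_decomp]).
    These tuples, of all lengths k together, form a finite set [decomp l c] of
    sequences, and the double sum of the hierarchy runs over the same sets
    ([sum_hierarchy]). Linearity of the integral concludes for [c] in T. At the
    other multi-indices both sides of the hierarchy vanish: the weight is
    additive, so a tuple in the sum has an entry of weight different from 1
    ([prod_coefT_eq0]). *)


(** * The enveloping algebra as differential operators *)

(** Lets the theory of iterated operators apply to [mindex_sum]. *)
HB.instance Definition _ (I : choiceType) :=
  Monoid.isComLaw.Build (cmonom I) (@onecm I) (@mulcm I)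
    (@mulcmA I) (@mulcmC I) (@mul0cm I).

(** The algebra of [diff_op_starD], over an abstract ring so that unification does
   not unfold the multiplication of polynomials. *)
Lemma leibniz_mul_sub (A : comNzRingType) (a b x da dx : A) :
  b * (da * x + a * dx) - b * da * x = a * (b * dx).
Proof. by rewrite mulrDr mulrA addrAC subrr add0r mulrCA. Qed.

Section Symbols.
Variables (R : realType) (L : finType).
Local Notation T := (Tspace R L).
Local Notation U := (Uenv R L).
Local Notation gen := (env_gen (@Tbracket R L)).
Implicit Types (a b : T) (u v : U) (w : zalg R L) (k : R).

(** The extension of [rhoD] from T to all polynomials: [diff_op_starD] applies the
    operators to [D w], which lies outside T when w lies in T. *)
Definition diff_act a w : zalg R L := Tval a * Defs.derivD w.
Definition diff_op u w : zalg R L := env_act diff_act u w.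

Let good w := True.
Let diff_actl w : good w -> linear (diff_act^~ w).
Proof. by move=> _ k a b; rewrite /diff_act /= mulrDl -scalerAl. Qed.
Let diff_actr a : linear (diff_act a).
Proof. by move=> k w w'; rewrite /diff_act derivD_linear mulrDr -scalerAr. Qed.
Let good_lin k w w' : good w -> good w' -> good (k *: w + w').
Proof. by []. Qed.
Let good_act a w : good w -> good (diff_act a w).
Proof. by []. Qed.
Let diff_act_br a b w : good w ->
  diff_act (Tbracket a b) w
  = diff_act a (diff_act b w) - diff_act b (diff_act a w).
Proof.
move=> _.
exact (leibniz_preLie (A := zalg R L) (Tval a) (Tval b) w (@derivDM R L)).
Qed.

Lemma diff_op1 w : diff_op 1 w = w.
Proof. exact: (env_act1 diff_actl diff_actr good_lin good_act diff_act_br). Qed.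

Lemma diff_op_genM a u w :
  diff_op (gen a * u) w = Tval a * Defs.derivD (diff_op u w).
Proof.
rewrite /diff_op (env_actM diff_actl diff_actr good_lin good_act diff_act_br) //.
by rewrite (env_act_gen diff_actl diff_actr good_lin good_act diff_act_br).
Qed.

Lemma diff_op_linearl w : linear (diff_op^~ w).
Proof.
exact: (env_act_linearl diff_actl diff_actr good_lin good_act diff_act_br).
Qed.

Lemma Tval_rhoD u a : Tval (rhoD u a) = diff_op u (Tval a).
Proof.
elim/env_mul_ind: u a => [|b u IH|k u v IHu IHv] a.
- by rewrite rhoD1 diff_op1.
- by rewrite rhoDM rhoD_gen diff_op_genM -IH.
- by rewrite rhoD_linearl diff_op_linearl -IHu -IHv.
Qed.

(** In the inductive step the defining equation of [starD] gives
    [b D(a * diff_op u (D w)) - (b D a) * diff_op u (D w)]; by the Leibniz rule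
    the term where D falls on a cancels. *)
Lemma diff_op_starD u a w :
  diff_op (starD u a) w = Tval a * diff_op u (Defs.derivD w).
Proof.
elim/env_mul_ind: u a w => [|b u IH|k u v IHu IHv] a w.
- by rewrite starD1 -[env_gen _ a]mulr1 diff_op_genM !diff_op1.
- rewrite starD_genM addrC -scaleN1r diff_op_linearl !diff_op_genM !IH.
  rewrite derivDM scaleN1r addrC.
  exact: (leibniz_mul_sub (A := zalg R L)).
- by rewrite starD_linearl !diff_op_linearl IHu IHv mulrDr -scalerAr.
Qed.

(** Each factor of the iterated product contributes its monomial on the left and
    one application of D on the right. *)
Lemma diff_op_starDs s w :
  diff_op (starDs 1 s) w
  = zmon R (mindex_sum (map val s)) * iter (size s) (@Defs.derivD R L) w.
Proof.
elim/last_ind: s w => [|s b IH] w.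
  rewrite diff_op1 /mindex_sum big_nil; exact: esym (mul1r _).
rewrite /starDs foldl_rcons -/(starDs 1 s) diff_op_starD IH size_rcons iterSr.
rewrite map_rcons /mindex_sum big_rcons /= mulcmC -zmonM.
exact: mulrA.
Qed.

Lemma derivD_zgen (l : L) (k : nat) :
  Defs.derivD (zgen R (l, k)) = k.+1%:R *: zgen R (l, k.+1) :> zalg R L.
Proof.
rewrite (derivDEw (r := [:: (l, k)])) //; last first.
  move=> v; rewrite mem_undup => /flatten_mapP [b].
  by rewrite msuppU1 in_fset1 => /eqP ->; rewrite mdomU in_fset1 inE.
rewrite big_seq1 partialz_zmon cmUU scale1r /zgen zmonM /=.
congr (_ *: zmon R _); apply/eqP/cmP => v.
by rewrite mulcmE divcmE subnn addn0.
Qed.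

Lemma iter_derivD_zgen (l : L) (k : nat) :
  iter k (@Defs.derivD R L) (zgen R (l, 0%N)) = k`!%:R *: zgen R (l, k).
Proof.
elim: k => [|k IH]; first by rewrite fact0 scale1r.
rewrite iterS IH linearZ /= derivD_zgen scalerA.
have -> : (k.+1)`!%:R = k`!%:R * k.+1%:R :> R by rewrite factS mulnC natrM.
reflexivity.
Qed.

End Symbols.

(** * Counting the orderings of a multiset *)

Section Multinomial.
Local Open Scope nat_scope.
Variables (T : eqType).
Implicit Types (s r : seq T).

Lemma sum_count_undup s : \sum_(x <- undup s) count_mem x s = size s.
Proof.
rewrite -sum1_size -[RHS]big_undup_iterop_count; apply: eq_bigr => x _.
by rewrite Monoid.iteropE iter_addn_0 mul1n.
Qed.

(** The multinomial coefficient, in multiplied-out form. The orderings of s are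
    classified by their first element x; removing x from s divides the product of
    the factorials by the multiplicity of x, and the multiplicities add up to the
    size of s. The product runs over a fixed r rather than over the elements of
    s, so that the same r serves for s and for s with x removed. *)
Lemma size_permutations_count s r : uniq r -> {subset s <= r} ->
  size (permutations s) * \prod_(x <- r) (count_mem x s)`! = (size s)`!.
Proof.
move=> ur; move Dn: (size s) => n; elim: n s Dn => [|n IH] s Dn sr.
  by rewrite (size0nil Dn) big1.
rewrite (perm_size (permutationsE _)) ?Dn // size_allpairs_dep sumnE big_map.
rewrite big_distrl /= factS -[in RHS]Dn -(sum_count_undup s) big_distrl /=.
apply: eq_big_seq => x; rewrite mem_undup => xs.
rewrite -(IH (rem x s)); last 2 first.
- by rewrite size_rem // Dn.
- by move=> y /mem_rem/sr.
rewrite mulnCA; congr (_ * _).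
rewrite !(bigD1_seq x (sr x xs) ur) /= mulnA; congr (_ * _).
  have : 0 < count_mem x s by rewrite -has_count has_pred1.
  by rewrite count_mem_rem eqxx subn1; case: (count_mem x s).
by apply: eq_bigr => y /negbTE yx; rewrite count_mem_rem eq_sym yx subn0.
Qed.

End Multinomial.

(** * Ordered decompositions of a multi-index *)

Section Finiteness.
Local Open Scope nat_scope.

Lemma finite_cmonom_le (S : choiceType) (c : cmonom S) :
  finite_set [set b : cmonom S | forall v, b v <= c v].
Proof.
pose n := \max_(v <- finsupp c) c v.
have cn v : c v <= n.
  have [vc|vc] := boolP (v \in finsupp c); last by rewrite fsfun_dflt.
  by rewrite /n (big_fsetD1 v) //= leq_maxl.
pose f (h : {ffun finsupp c -> 'I_n.+1}) : cmonom S :=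
  CMonom [fsfun v : finsupp c => h v : nat | 0].
apply: (@sub_finite_set _ _ (f @` setT)); last exact/finite_image/finite_finset.
move=> b bc; exists [ffun v => inord (b (val v))] => //.
apply/eqP/cmP => v; rewrite /f /= fsfun_ffun.
case: insubP => [w _ <-|vc] /=.
  by rewrite ffunE inordK // ltnS (leq_trans (bc _) (cn _)).
by have := bc v; rewrite (fsfun_dflt vc) leqn0 => /eqP.
Qed.

(** Bounding the length, instead of fixing it, lets the induction on n remove the
    first entry. *)
Lemma finite_seq_size_le (S : choiceType) (B : set S) n : finite_set B ->
  finite_set [set t : seq S | size t <= n /\ forall b, b \in t -> B b].
Proof.
move=> fB; elim: n => [|n IH].
  apply: (@sub_finite_set _ _ [set [::]]); last exact: finite_set1.
  by move=> t /= [+ _]; rewrite leqn0 => /nilP.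
set A := [set t : seq S | _] in IH.
apply: (@sub_finite_set _ _ ([set [::]] `|` (fun p => p.1 :: p.2) @` (B `*` A))).
  move=> [|b t] /= [tn tB]; first by left.
  right; exists (b, t) => //; split => /=; first by apply: tB; rewrite mem_head.
  by split => // b' b't; apply: tB; rewrite in_cons b't orbT.
rewrite finite_setU; split; first exact: finite_set1.
exact/finite_image/finite_setX.
Qed.

End Finiteness.

Section Decompositions.
Variables (L : finType).
Implicit Types (l : L) (c : mindex L) (t : seq (mindex L)).

(** The tuples of all lengths that contribute to the hierarchy at c with label l.
    Sequences replace tuples so that all lengths live in one type. *)
Definition decomp l c : set (seq (mindex L)) :=
  [set t | mulcm (ucm (l, size t)) (mindex_sum t) = c].

Lemma mindex_sum_ge t b v : b \in t -> (b v <= mindex_sum t v)%N.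
Proof.
move=> bt; rewrite /mindex_sum (perm_big _ (perm_to_rem bt)) big_cons mulcmE.
exact: leq_addr.
Qed.

(** A tuple of length k can only contribute at c if c contains some variable
    [z_(l,k)]. *)
Definition max_level c : nat := \max_(v <- finsupp c) v.2.

Lemma decomp_size_le l c t : decomp l c t -> (size t <= max_level c)%N.
Proof.
move=> <-; rewrite /max_level; set d := mulcm _ _.
have vd : (l, size t) \in finsupp d by rewrite -cmE_neq0 mulcmE cmUU.
by rewrite (big_fsetD1 _ vd) leq_maxl.
Qed.

Lemma finite_decomp l c : finite_set (decomp l c).
Proof.
apply: sub_finite_set (finite_seq_size_le (max_level c) (finite_cmonom_le c)).
move=> t tc; split=> [|b bt v]; first exact: decomp_size_le tc.
by rewrite -tc mulcmE (leq_trans (mindex_sum_ge v bt)) // leq_addl.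
Qed.

(** Forgetting the length identifies the k-tuples with the sequences of
    length k. *)
Lemma sum_tuples_decomp (R : nmodType) (v : L * nat) c (F : seq (mindex L) -> R) :
  \sum_(bs \in [set bs : v.2.-tuple (mindex L)
                  | mulcm (ucm v) (mindex_sum bs) = c]) F bs
  = \sum_(t <- fset_set (decomp v.1 c) | size t == v.2) F t.
Proof.
case: v => l k /=; set S := [set bs : k.-tuple _ | _].
have inj : set_inj S (tval (n := k) (T := mindex L)).
  by move=> a b _ _; exact: val_inj.
rewrite -(@fsbig_image R 0 +%R _ _ S _ F inj).
have -> : (tval (n := k) (T := mindex L)) @` S
    = [set` [seq t <- fset_set (decomp l c) | size t == k]].
  apply/seteqP; split=> [_ [bs bsS <-]|t] /=; rewrite mem_filter.
    rewrite size_tuple eqxx in_fset_set ?inE; last exact: finite_decomp.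
    by rewrite /decomp /= size_tuple.
  move=> /andP [/eqP tk]; rewrite in_fset_set ?inE; last exact: finite_decomp.
  by rewrite /decomp /= tk => tc; exists (Tuple (introT eqP tk)).
by rewrite -fsbig_seq ?big_filter // filter_uniq // fset_uniq.
Qed.

(** The length of the sequence determines the index k, so the sum over k and
    over tuples of length k is a single finite sum over sequences. *)
Lemma sum_hierarchy (R : nmodType) c (G : L -> seq (mindex L) -> R) :
  \sum_(v \in [set: L * nat])
    \sum_(bs \in [set bs : v.2.-tuple (mindex L)
                    | mulcm (ucm v) (mindex_sum bs) = c]) G v.1 bs
  = \sum_(l : L) \sum_(t <- fset_set (decomp l c)) G l t.
Proof.
under eq_fsbigr do rewrite (sum_tuples_decomp _ _ (G _)).
pose r := [seq (l, k) | l <- enum L, k <- index_iota 0 (max_level c).+1].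
have ur : uniq r by rewrite allpairs_uniq ?enum_uniq ?iota_uniq // => -[? ?] [].
have size_le l t : t \in fset_set (decomp l c) -> (size t < (max_level c).+1)%N.
  rewrite in_fset_set ?inE; last exact: finite_decomp.
  by rewrite ltnS; exact: decomp_size_le.
rewrite (fsbigE r) //; last first.
  move=> [l k] _ lk; rewrite big_seq_cond big1 // => t /= /andP [tc /eqP tk].
  case/negP: lk; apply/allpairsP; exists (l, k); split=> [||//].
    by rewrite mem_enum.
  by rewrite mem_index_iota -tk (size_le l).
under eq_bigl do rewrite in_setT.
rewrite big_allpairs big_enum; apply: eq_bigr => l _.
rewrite /= (exchange_big_dep xpredT) //= big_seq [RHS]big_seq.
apply: eq_bigr => t tc.
under eq_bigl do rewrite eq_sym.
by rewrite big_nat1_eq /= (size_le l).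
Qed.

End Decompositions.

(** * The components of the exponential series *)

Section ExpCoefficients.
Variables (R : realType) (L : finType).
Local Notation T := (Tspace R L).
Implicit Types (l : L) (d : Tindex L) (I : cmonom (Tindex L)).

Definition weight1 (t : seq (mindex L)) : bool := all (fun b => weight b == 1) t.

Lemma prod_coefT_weight (f : Tstar R L) t :
  ~~ weight1 t -> \prod_(b <- t) coefT f b = 0.
Proof.
by move=> /allPn [b bt wb]; rewrite (big_rem b) //= /coefT insubN ?mul0r.
Qed.

Lemma toTstar_Tmon d d' : toTstar (Tmon R d) d' = (d == d')%:R.
Proof. by rewrite /toTstar mcoeffU1 val_eqE. Qed.

Lemma rhoD_star_Tmon u d d' :
  rhoD_star u (toTstar (Tmon R d)) d' = toTstar (rhoD u (Tmon R d)) d'.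
Proof.
rewrite /rhoD_star (fsbigE [:: d]) //=; last first.
  move=> e _; rewrite inE eq_sym => /negbTE ed.
  by rewrite toTstar_Tmon ed mul0r.
by rewrite big_mkcond big_seq1 in_setT toTstar_Tmon eqxx mul1r.
Qed.

Definition mset_seq (s : seq (Tindex L)) : cmonom (Tindex L) :=
  \big[@mulcm _/onecm _]_(b <- s) ucm b.

Lemma mset_seqE s b : mset_seq s b = count_mem b s.
Proof.
elim: s => [|a s IH]; first by rewrite /mset_seq big_nil onecmE.
by rewrite /mset_seq big_cons mulcmE ucmE -/(mset_seq s) IH.
Qed.

Lemma mset_mlist I : mset_seq (mlist I) = I.
Proof. by apply/eqP/cmP => b; rewrite mset_seqE count_mlist. Qed.

Lemma mem_mlist I b : (b \in mlist I) = (b \in finsupp I).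
Proof. by rewrite -has_pred1 has_count count_mlist lt0n cmE_neq0. Qed.

Lemma perm_mlist s I : perm_eq s (mlist I) = (mset_seq s == I).
Proof.
apply/idP/eqP => [sI|<-].
  by rewrite -[RHS]mset_mlist; apply/eqP/cmP=> b; rewrite !mset_seqE (permP sI).
by apply/allP => b _ /=; rewrite count_mlist mset_seqE.
Qed.

(** The monomial [f^I] is the product of f along any ordering of I. *)
Lemma expD_perm (f : Tstar R L) s I :
  perm_eq s (mlist I) -> expD f I = \prod_(b <- s) f b.
Proof.
move=> sI; rewrite (perm_big _ sI) /= /expD -[RHS]GRing.prodr_undup_exp_count.
rewrite [LHS](perm_big (undup (mlist I))); last first.
  apply: uniq_perm; [exact: (fset_uniq (finsupp I))|exact: undup_uniq|move=> b].
  by rewrite mem_undup mem_mlist.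
by apply: eq_bigr => b _; rewrite count_mlist.
Qed.

Lemma size_permutations_mlist I :
  (size (mlist I))`!%:R = (mfact I)%:R * (size (permutations (mlist I)))%:R :> R.
Proof.
rewrite -natrM; congr (_%:R).
rewrite -(@size_permutations_count _ (mlist I) (finsupp I)) ?fset_uniq //.
  by rewrite mulnC; congr (_ * _)%N; apply: eq_bigr => b _; rewrite count_mlist.
by move=> b; rewrite mem_mlist.
Qed.

Lemma mfact_neq0 I : (mfact I)%:R != 0 :> R.
Proof.
rewrite pnatr_eq0 -lt0n /mfact prodn_cond_gt0 // => b _; exact: fact_gt0.
Qed.

(** The coefficient is [k!/I!] for [k = size (mlist I)], written as the number of
    orderings of I. *)
Lemma rhoD_Zbasis_coef I l d :
  toTstar (rhoD (Zbasis R I) (Tgen0 R l)) d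
  = (size (permutations (mlist I)))%:R
    * (mulcm (ucm (l, size (mlist I))) (mindex_sum (map val (mlist I)))
       == val d)%:R.
Proof.
have zl : Tval (Tgen0 R l) = zgen R (l, 0%N) by [].
rewrite /toTstar Tval_rhoD zl /Zbasis -[_ *: starDs _ _]addr0 diff_op_linearl.
have -> w : diff_op 0 w = 0 :> zalg R L.
  by rewrite -(subrr 1) -scaleN1r addrC diff_op_linearl scaleN1r addNr.
rewrite addr0 diff_op_starDs iter_derivD_zgen.
set b := mindex_sum _; set k := size _.
have -> : zmon R b * (k`!%:R *: zgen R (l, k))
    = k`!%:R *: zmon R (mulcm (ucm (l, k)) b).
  by rewrite mulcmC -zmonM; exact: (esym (scalerAr _ _ _)).
rewrite !mcoeffZ mcoeffU1 size_permutations_mlist mulrA; congr (_ * _).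
by rewrite mulrA mulVf ?mul1r // mfact_neq0.
Qed.

(** Multisets I with their orderings correspond to ordered sequences: the
    right-hand side lists each sequence of indices of T once, as an ordering of
    the multiset of its entries, and the sequences with an entry outside T
    contribute 0. *)
Lemma rhoD_series_decomp (f : Tstar R L) l d :
  rhoD_series (expD f) (toTstar (Tgen0 R l)) d
  = \sum_(t <- fset_set (decomp l (val d))) \prod_(b <- t) coefT f b.
Proof.
pose P (s : seq (Tindex L)) : Prop := decomp l (val d) (map val s).
have Pperm s s' : perm_eq s s' -> P s -> P s'.
  move=> ss'; rewrite /P /decomp /= !size_map (perm_size ss') => <-.
  by rewrite /mindex_sum (perm_big _ (perm_map val ss')).
pose A : set (cmonom (Tindex L)) := [set I | P (mlist I)].
have mem_decomp t : (t \in fset_set (decomp l (val d))) <-> decomp l (val d) t.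
  by rewrite in_fset_set ?inE; last exact: finite_decomp.
(* Each I in A is the multiset of the entries of a decomposition. *)
have fA : finite_set A.
  pose g t := mset_seq (pmap insub t).
  apply: (@sub_finite_set _ _ (g @` decomp l (val d))); last first.
    exact/finite_image/finite_decomp.
  move=> I AI; exists (map val (mlist I)) => //.
  by rewrite /g (map_pK valK) mset_mlist.
have mem_A I : (I \in fset_set A) <-> P (mlist I).
  by rewrite in_fset_set ?inE.
rewrite /rhoD_series -(fsbig_widen A) //; last first.
  move=> I [_ nAI] /=; rewrite rhoD_star_Tmon rhoD_Zbasis_coef.
  have -> : (mulcm (ucm (l, size (mlist I)))
      (mindex_sum (map val (mlist I))) == val d) = false.
    by apply/negbTE/eqP => E; apply: nAI; rewrite /A /P /decomp /= size_map.
  by rewrite !mulr0.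
rewrite fsbig_finite //.
transitivity (\sum_(I <- fset_set A) \sum_(s <- permutations (mlist I))
                \prod_(b <- map val s) coefT f b).
  rewrite big_seq [RHS]big_seq; apply: eq_bigr => I /mem_A PI.
  rewrite rhoD_star_Tmon rhoD_Zbasis_coef.
  have -> : mulcm (ucm (l, size (mlist I)))
      (mindex_sum (map val (mlist I))) == val d.
    by apply/eqP; move: PI; rewrite /P /decomp /= size_map.
  rewrite mulr1 mulr_natr -iter_addr_0 -(count_predT (permutations _)).
  rewrite -big_const_seq big_seq [RHS]big_seq; apply: eq_bigr => s.
  rewrite mem_permutations => sI; rewrite (expD_perm f sI) big_map.
  by apply: eq_bigr => b _; rewrite /coefT valK.
rewrite -(big_allpairs_dep (h := fun I s => map val s)
  (F := fun t => \prod_(b <- t) coefT f b)).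
rewrite [RHS](bigID weight1) /= [X in _ = _ + X]big1 ?addr0; last first.
  by move=> t; exact: prod_coefT_weight.
rewrite -[RHS]big_filter; apply: perm_big; apply: uniq_perm.
- apply: allpairs_uniq_dep => [|I _|]; rewrite ?fset_uniq ?permutations_uniq //.
  move=> [I s] [J s'] /allpairsPdep [I1 [s1 [_ sI E]]].
  move=> /allpairsPdep [J1 [s2 [_ sJ E']]] /= /(inj_map val_inj) ss'.
  move: sI sJ; rewrite !mem_permutations !perm_mlist.
  case: E E' => <- <- [<- <-] /eqP <- /eqP <-.
  by rewrite ss'.
- by rewrite filter_uniq // fset_uniq.
move=> t; rewrite mem_filter; apply/allpairsPdep/andP.
  move=> [I [s [/mem_A PI]]]; rewrite mem_permutations perm_sym => sI ->.
  split; last by apply/mem_decomp; exact: Pperm sI PI.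
  by apply/allP => _ /mapP [b _ ->]; exact: (valP b).
move=> [/allP wt /mem_decomp tc]; pose s : seq (Tindex L) := pmap insub t.
have st : map val s = t.
  rewrite (pmap_filter (@insubK _ _ _)); apply/all_filterP/allP => b /wt.
  by rewrite /= isSome_insub.
exists (mset_seq s), s.
have sI : perm_eq s (mlist (mset_seq s)) by rewrite perm_mlist.
rewrite mem_permutations sI st; split=> //; apply/mem_A.
by apply: Pperm sI _; rewrite /P st.
Qed.

Lemma weight_mindex_sum (t : seq (mindex L)) :
  weight (mindex_sum t) = \sum_(b <- t) weight b.
Proof.
elim: t => [|b t IH]; last by rewrite /mindex_sum !big_cons weightM -IH.
by rewrite /mindex_sum !big_nil /weight mdom1 big_seq_fset0.
Qed.

(** If all k entries of t have weight 1, then [e_(l,k)] plus their sum has weight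
    [(1 - k) + k = 1]. *)
Lemma prod_coefT_eq0 (f : Tstar R L) l c t :
  decomp l c t -> weight c != 1 -> \prod_(b <- t) coefT f b = 0.
Proof.
move=> tc wc; apply: prod_coefT_weight; apply: contraNN wc => /allP wt.
rewrite -tc weightM weightU weight_mindex_sum.
rewrite (eq_big_seq (fun=> 1)); last by move=> b /wt/eqP.
by rewrite big_const_seq count_predT iter_addr_0 /= natz subrK.
Qed.

End ExpCoefficients.

(** * Linearity of the oriented integral *)

Section Integrals.
Variable (R : realType).
Implicit Types (X f g : R -> R) (s t : R).

Lemma dintD X f g s t :
  dint_integrable X f s t -> dint_integrable X g s t ->
  dint X (fun u => f u + g u) s t = dint X f s t + dint X g s t.
Proof.
rewrite /dint_integrable /dint;
case: (leP s t) => st hf hg.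
  under eq_Rintegral do rewrite mulrDl.
  by rewrite RintegralD.
under eq_Rintegral do rewrite mulrDl.
by rewrite RintegralD // opprD.
Qed.

Lemma dint0 X s t : dint X (fun=> 0) s t = 0.
Proof.
rewrite /dint; under eq_Rintegral do rewrite mul0r.
under [X in - X]eq_Rintegral do rewrite mul0r.
by rewrite /Rintegral !integral0 /= oppr0 if_same.
Qed.

Lemma dint_integrable_sum X (I : eqType) (r : seq I) (F : I -> R -> R) s t :
  (forall i, i \in r -> dint_integrable X (F i) s t) ->
  dint_integrable X (fun u => \sum_(i <- r) F i u) s t.
Proof.
elim: r => [|i r IH] h.
  rewrite /dint_integrable; apply: eq_integrable (integrable0 _ _) => //.
  by move=> u _ /=; rewrite big_nil mul0r.
have hi := h i (mem_head _ _).
have hr := IH (fun j jr => h j (mem_behead (s := i :: r) jr)).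
apply: eq_integrable (integrableD _ hi hr) => //.
by move=> u _ /=; rewrite big_cons mulrDl EFinD.
Qed.

Lemma dint_sum X (I : eqType) (r : seq I) (F : I -> R -> R) s t :
  (forall i, i \in r -> dint_integrable X (F i) s t) ->
  dint X (fun u => \sum_(i <- r) F i u) s t = \sum_(i <- r) dint X (F i) s t.
Proof.
elim: r => [|i r IH] h.
  by under eq_fun do rewrite big_nil; rewrite big_nil dint0.
have hr j : j \in r -> dint_integrable X (F j) s t.
  by move=> jr; apply: h; rewrite in_cons jr orbT.
under eq_fun do rewrite big_cons.
rewrite dintD ?IH ?big_cons //; first exact: h (mem_head _ _).
exact: dint_integrable_sum.
Qed.

End Integrals.

(** * The equivalence *)

Theorem lemma3p6 (R : realType) (L : finType) (X : L -> R -> R)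
    (x : R -> R -> Tstar R L)
    (X_smooth : forall l, smooth01 (X l))
    (integrable_hierarchy : forall s t : R, 0 <= s <= 1 -> 0 <= t <= 1 ->
      forall (v : L * nat) (bs : v.2.-tuple (mindex L)),
      dint_integrable (X v.1) (fun u => \prod_(b <- bs) coefT (x s u) b) s t)
    (integrable_exp : forall s t : R, 0 <= s <= 1 -> 0 <= t <= 1 ->
      forall (l : L) (c : Tindex L),
      dint_integrable (X l)
        (fun u => rhoD_series (expD (x s u)) (toTstar (Tgen0 R l)) c) s t) :
  (forall s t : R, 0 <= s <= 1 -> 0 <= t <= 1 ->
    forall beta : mindex L,
    coefT (x s t) beta =
    \sum_(v \in [set: L * nat])
      \sum_(bs \in [set bs : v.2.-tuple (mindex L)
                      | mulcm (ucm v) (mindex_sum bs) = beta])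
        dint (X v.1) (fun u => \prod_(b <- bs) coefT (x s u) b) s t)
  <->
  (forall s t : R, 0 <= s <= 1 -> 0 <= t <= 1 ->
    x s t =
    \sum_(l : L)
      dintT (X l)
        (fun u => rhoD_series (expD (x s u)) (toTstar (Tgen0 R l))) s t).
Proof.
pose G s t l (bs : seq (mindex L)) :=
  dint (X l) (fun u => \prod_(b <- bs) coefT (x s u) b) s t.
have hierE s t c := sum_hierarchy c (G s t).
have expE s t (c : Tindex L) : 0 <= s <= 1 -> 0 <= t <= 1 ->
    (\sum_(l : L)
      dintT (X l)
        (fun u => rhoD_series (expD (x s u)) (toTstar (Tgen0 R l))) s t) c
    = \sum_(l : L) \sum_(bs <- fset_set (decomp l (val c))) G s t l bs.
  move=> s01 t01; rewrite fct_sumE; apply: eq_bigr => l _; rewrite /dintT.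
  under eq_fun do rewrite rhoD_series_decomp.
  apply: dint_sum => bs _.
  exact: (integrable_hierarchy s t s01 t01 (l, size bs) (in_tuple bs)).
split=> [h s t s01 t01|h s t s01 t01 c].
  apply/funext => c; rewrite expE // -hierE -h //.
  by rewrite /coefT valK.
rewrite (hierE s t c) /coefT; case: insubP => [d _ <-|wc].
  by rewrite h // expE.
rewrite big1 // => l _; rewrite big_seq big1 // => bs.
rewrite in_fset_set ?inE => [bsc|]; last exact: finite_decomp.
rewrite /G -(dint0 (X l) s t); congr dint; apply/funext => u.
exact: prod_coefT_eq0 bsc wc.
Qed.
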